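(* For every set of formulas $\Gamma\cup\{A\}\subseteq For(\Sigma)$: if $\Gamma\vdash_{LET_K^+}A$ then $\Gamma\models_{\mathcal{M}_6}A$.
   Context: $For(\Sigma)$ is the set of formulas over a denumerable set of propositional variables and $\Sigma=\{\land,\lor,\to,\neg,\circ\}$. The logic $LET_K$ is the natural deduction system with rules: ($\land$I) from $A,B$ infer $A\land B$; ($\land$E) from $A\land B$ infer $A$ and $B$; ($\lor$I) from $A$ (or from $B$) infer $A\lor B$; ($\lor$E) from $A\lor B$ and derivations of $C$ from $[A]$ and from $[B]$ infer $C$; ($\neg\land$I) from $\neg A$ (or $\neg B$) infer $\neg(A\land B)$; ($\neg\land$E) from $\neg(A\land B)$ and derivations of $C$ from $[\neg A]$ and from $[\neg B]$ infer $C$; ($\neg\lor$I) from $\neg A,\neg B$ infer $\neg(A\lor B)$; ($\neg\lor$E) from $\neg(A\lor B)$ infer $\neg A$ and $\neg B$; (DN) $A$ and $\neg\neg A$ are inter-derivable; ($\to$I) from a derivation of $B$ from $[A]$ infer $A\to B$; ($\to$E) from $A\to B$ and $A$ infer $B$; ($\to_{CL}$) axiom $A\lor(A\to B)$; ($\neg\to$I) from $A,\neg B$ infer $\neg(A\to B)$; ($\neg\to$E) from $\neg(A\to B)$ infer $A$ and $\neg B$; (EXP$^\circ$) from $\circ A,A,\neg A$ infer $B$; (PEM$^\circ$) from $\circ A$ infer $A\lor\neg A$ (bracketed hypotheses are discharged). Write $A^T$ for $\circ A\land A$, $A^F$ for $\circ A\land\neg A$. $LET_K^+$ adds: (I$\circ$)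 axiom $\circ\circ A$; (I$\neg\circ$) from $\circ A$ infer $\circ\neg A$; (E$\neg\circ$) from $\circ\neg A$ infer $\circ A$; (I$\land$T) from $A^T,B^T$ infer $(A\land B)^T$; (I$\land$F) from $A^F$ (or $B^F$) infer $(A\land B)^F$; (I$\lor$T) from $A^T$ (or $B^T$) infer $(A\lor B)^T$; (I$\lor$F) from $A^F,B^F$ infer $(A\lor B)^F$; (I$\to$T) from $A^F$ (or $B^T$) infer $(A\to B)^T$; (I$\to$F) from $A,B^F$ infer $(A\to B)^F$; (E$\land$T) from $(A\land B)^T$ infer $A^T$ and $B^T$; (E$\land$F) from $(A\land B)^F$ and derivations of $C$ from $[A^F]$ and from $[B^F]$ infer $C$; (E$\lor$T) from $(A\lor B)^T$ and derivations of $C$ from $[A^T]$ and from $[B^T]$ infer $C$; (E$\lor$F) from $(A\lor B)^F$ infer $A^F$ and $B^F$; (E$\to$T) from $(A\to B)^T$ and derivations of $C$ from $[A^F]$ and from $[B^T]$ infer $C$; (E$\to$F) from $(A\to B)^F$ infer $A$ and $B^F$. $\Gamma\vdash_{LET_K^+}A$ means derivability from premises in $\Gamma$. Let $\{0,1\}$ be the two-element Boolean algebra with $\sqcap,\sqcup,\sim$, $a\Rightarrow b=\sim a\sqcup b$. $\mathcal{M}_6$ is the logical matrix with domain $B_{LET_K}=\{z\in\{0,1\}^3:z_3\le z_1\sqcup z_2,\ z_1\sqcap z_2\sqcap z_3=0\}=\{T=(1,0,1),T_0=(1,0,0),\mathsf{b}=(1,1,0),\mathsf{n}=(0,0,0),F_0=(0,1,0),F=(0,1,1)\}$,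 designated set $\mathrm{D}=\{T,T_0,\mathsf{b}\}$, and operations: $z\tilde\land w=(z_1\sqcap w_1,\ z_2\sqcup w_2,\ (z_1\sqcap z_3\sqcap w_1\sqcap w_3)\sqcup(z_2\sqcap z_3)\sqcup(w_2\sqcap w_3))$; $z\tilde\lor w=(z_1\sqcup w_1,\ z_2\sqcap w_2,\ (z_2\sqcap z_3\sqcap w_2\sqcap w_3)\sqcup(z_1\sqcap z_3)\sqcup(w_1\sqcap w_3))$; $z\tilde\to w=(z_1\Rightarrow w_1,\ z_1\sqcap w_2,\ (z_1\sqcap w_2\sqcap w_3)\sqcup(z_2\sqcap z_3)\sqcup(w_1\sqcap w_3))$; $\tilde\neg z=(z_2,z_1,z_3)$; $\tilde\circ z=(z_3,\sim z_3,1)$. A valuation is a homomorphism from the formula algebra into this algebra; $\Gamma\models_{\mathcal{M}_6}A$ iff every valuation sending all formulas of $\Gamma$ into $\mathrm{D}$ sends $A$ into $\mathrm{D}$. *)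

(* Defs.v *)
From mathcomp Require Import all_boot.
From mathcomp Require Import classical_sets.

Set Implicit Arguments.
Unset Strict Implicit.
Unset Printing Implicit Defensive.

Local Open Scope classical_set_scope.

Inductive form : Type :=
  | Var of nat
  | And of form & form
  | Or of form & form
  | Imp of form & form
  | Neg of form
  | Circ of form.

Declare Scope formula_scope.
Delimit Scope formula_scope with formula.
Bind Scope formula_scope with form.

Notation "A ⋀ B" := (And A B) (at level 40, left associativity) : formula_scope.
Notation "A ⋁ B" := (Or A B) (at level 50, left associativity) : formula_scope.
Notation "A ⊃ B" := (Imp A B) (at level 55, right associativity) : formula_scope.
Notation "¬ A" := (Neg A) (at level 35, right associativity) : formula_scope.
Notation "∘ A" := (Circ A) (at level 35, right associativity) : formula_scope.
Notation "A ^T" := (And (Circ A) A) (at level 8, format "A ^T") : formula_scope.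
Notation "A ^F" := (And (Circ A) (Neg A)) (at level 8, format "A ^F") : formula_scope.

Local Open Scope formula_scope.

Reserved Notation "G ⊢ A" (at level 70, no associativity).

(* [G ⊢ A]: there is a natural deduction derivation of A whose undischarged
   hypotheses all belong to G. A hypothesis H that a rule discharges is one
   that the corresponding subderivation may use in addition to G, that is,
   G `|` [set H]. *)
Inductive LETKplus : set form -> form -> Prop :=
  | Hyp G A : G A -> G ⊢ A
  | AndI G A B : G ⊢ A -> G ⊢ B -> G ⊢ A ⋀ B
  | AndE1 G A B : G ⊢ A ⋀ B -> G ⊢ A
  | AndE2 G A B : G ⊢ A ⋀ B -> G ⊢ B
  | OrI1 G A B : G ⊢ A -> G ⊢ A ⋁ B
  | OrI2 G A B : G ⊢ B -> G ⊢ A ⋁ B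
  | OrE G A B C :
      G ⊢ A ⋁ B -> G `|` [set A] ⊢ C -> G `|` [set B] ⊢ C -> G ⊢ C
  | NegAndI1 G A B : G ⊢ ¬ A -> G ⊢ ¬ (A ⋀ B)
  | NegAndI2 G A B : G ⊢ ¬ B -> G ⊢ ¬ (A ⋀ B)
  | NegAndE G A B C :
      G ⊢ ¬ (A ⋀ B) -> G `|` [set ¬ A] ⊢ C -> G `|` [set ¬ B] ⊢ C -> G ⊢ C
  | NegOrI G A B : G ⊢ ¬ A -> G ⊢ ¬ B -> G ⊢ ¬ (A ⋁ B)
  | NegOrE1 G A B : G ⊢ ¬ (A ⋁ B) -> G ⊢ ¬ A
  | NegOrE2 G A B : G ⊢ ¬ (A ⋁ B) -> G ⊢ ¬ B
  | DNI G A : G ⊢ A -> G ⊢ ¬ ¬ A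
  | DNE G A : G ⊢ ¬ ¬ A -> G ⊢ A
  | ImpI G A B : G `|` [set A] ⊢ B -> G ⊢ A ⊃ B
  | ImpE G A B : G ⊢ A ⊃ B -> G ⊢ A -> G ⊢ B
  | ImpCL G A B : G ⊢ A ⋁ (A ⊃ B)
  | NegImpI G A B : G ⊢ A -> G ⊢ ¬ B -> G ⊢ ¬ (A ⊃ B)
  | NegImpE1 G A B : G ⊢ ¬ (A ⊃ B) -> G ⊢ A
  | NegImpE2 G A B : G ⊢ ¬ (A ⊃ B) -> G ⊢ ¬ B
  | ExpCirc G A B : G ⊢ ∘ A -> G ⊢ A -> G ⊢ ¬ A -> G ⊢ B
  | PemCirc G A : G ⊢ ∘ A -> G ⊢ A ⋁ ¬ A
  | CircI G A : G ⊢ ∘ ∘ A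
  | NegCircI G A : G ⊢ ∘ A -> G ⊢ ∘ ¬ A
  | NegCircE G A : G ⊢ ∘ ¬ A -> G ⊢ ∘ A
  | AndTI G A B : G ⊢ A^T -> G ⊢ B^T -> G ⊢ (A ⋀ B)^T
  | AndFI1 G A B : G ⊢ A^F -> G ⊢ (A ⋀ B)^F
  | AndFI2 G A B : G ⊢ B^F -> G ⊢ (A ⋀ B)^F
  | OrTI1 G A B : G ⊢ A^T -> G ⊢ (A ⋁ B)^T
  | OrTI2 G A B : G ⊢ B^T -> G ⊢ (A ⋁ B)^T
  | OrFI G A B : G ⊢ A^F -> G ⊢ B^F -> G ⊢ (A ⋁ B)^F
  | ImpTI1 G A B : G ⊢ A^F -> G ⊢ (A ⊃ B)^T
  | ImpTI2 G A B : G ⊢ B^T -> G ⊢ (A ⊃ B)^T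
  | ImpFI G A B : G ⊢ A -> G ⊢ B^F -> G ⊢ (A ⊃ B)^F
  | AndTE1 G A B : G ⊢ (A ⋀ B)^T -> G ⊢ A^T
  | AndTE2 G A B : G ⊢ (A ⋀ B)^T -> G ⊢ B^T
  | AndFE G A B C :
      G ⊢ (A ⋀ B)^F -> G `|` [set A^F] ⊢ C -> G `|` [set B^F] ⊢ C -> G ⊢ C
  | OrTE G A B C :
      G ⊢ (A ⋁ B)^T -> G `|` [set A^T] ⊢ C -> G `|` [set B^T] ⊢ C -> G ⊢ C
  | OrFE1 G A B : G ⊢ (A ⋁ B)^F -> G ⊢ A^F
  | OrFE2 G A B : G ⊢ (A ⋁ B)^F -> G ⊢ B^F
  | ImpTE G A B C :
      G ⊢ (A ⊃ B)^T -> G `|` [set A^F] ⊢ C -> G `|` [set B^T] ⊢ C -> G ⊢ C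
  | ImpFE1 G A B : G ⊢ (A ⊃ B)^F -> G ⊢ A
  | ImpFE2 G A B : G ⊢ (A ⊃ B)^F -> G ⊢ B^F
where "G ⊢ A" := (LETKplus G A).

Record logical_matrix : Type := LogicalMatrix {
  carrier :> Type;
  designated : set carrier;
  mx_and : carrier -> carrier -> carrier;
  mx_or : carrier -> carrier -> carrier;
  mx_imp : carrier -> carrier -> carrier;
  mx_neg : carrier -> carrier;
  mx_circ : carrier -> carrier
}.

Record valuation (M : logical_matrix) (v : form -> M) : Prop := Valuation {
  val_and A B : v (A ⋀ B) = mx_and (v A) (v B);
  val_or A B : v (A ⋁ B) = mx_or (v A) (v B);
  val_imp A B : v (A ⊃ B) = mx_imp (v A) (v B);
  val_neg A : v (¬ A) = mx_neg (v A);
  val_circ A : v (∘ A) = mx_circ (v A)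
}.

Definition entails (M : logical_matrix) (G : set form) (A : form) : Prop :=
  forall v : form -> M, valuation v ->
    (forall B, G B -> designated (v B)) -> designated (v A).

Definition triple : Type := (bool * bool * bool)%type.

Definition in_BLETK (z : triple) : bool :=
  let: (z1, z2, z3) := z in
  (z3 <= (z1 || z2))%N && ~~ [&& z1, z2 & z3].

Definition BLETK : Type := {z : triple | in_BLETK z}.

Definition triple_and (z w : triple) : triple :=
  let: (z1, z2, z3) := z in let: (w1, w2, w3) := w in
  (z1 && w1, z2 || w2,
   [|| [&& z1, z3, w1 & w3], z2 && z3 | w2 && w3]).

Definition triple_or (z w : triple) : triple :=
  let: (z1, z2, z3) := z in let: (w1, w2, w3) := w in
  (z1 || w1, z2 && w2,
   [|| [&& z2, z3, w2 & w3], z1 && z3 | w1 && w3]).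

Definition triple_imp (z w : triple) : triple :=
  let: (z1, z2, z3) := z in let: (w1, w2, w3) := w in
  (~~ z1 || w1, z1 && w2,
   [|| [&& z1, w2 & w3], z2 && z3 | w1 && w3]).

Definition triple_neg (z : triple) : triple :=
  let: (z1, z2, z3) := z in (z2, z1, z3).

Definition triple_circ (z : triple) : triple :=
  let: (z1, z2, z3) := z in (z3, ~~ z3, true).

Lemma triple_and_closed (z w : BLETK) : in_BLETK (triple_and (val z) (val w)).
Proof. by case: z w => [[[[] []] []] ?] [[[[] []] []] ?]. Qed.

Lemma triple_or_closed (z w : BLETK) : in_BLETK (triple_or (val z) (val w)).
Proof. by case: z w => [[[[] []] []] ?] [[[[] []] []] ?]. Qed.

Lemma triple_imp_closed (z w : BLETK) : in_BLETK (triple_imp (val z) (val w)).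
Proof. by case: z w => [[[[] []] []] ?] [[[[] []] []] ?]. Qed.

Lemma triple_neg_closed (z : BLETK) : in_BLETK (triple_neg (val z)).
Proof. by case: z => [[[[] []] []] ?]. Qed.

Lemma triple_circ_closed (z : BLETK) : in_BLETK (triple_circ (val z)).
Proof. by case: z => [[[[] []] []] ?]. Qed.

Definition valT : BLETK := exist _ (true, false, true) isT.
Definition valT0 : BLETK := exist _ (true, false, false) isT.
Definition valb : BLETK := exist _ (true, true, false) isT.

Definition M6 : logical_matrix := {|
  carrier := BLETK;
  designated := [set valT; valT0; valb];
  mx_and z w := exist _ (triple_and (val z) (val w)) (triple_and_closed z w);
  mx_or z w := exist _ (triple_or (val z) (val w)) (triple_or_closed z w);
  mx_imp z w := exist _ (triple_imp (val z) (val w)) (triple_imp_closed z w);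
  mx_neg z := exist _ (triple_neg (val z)) (triple_neg_closed z);
  mx_circ z := exist _ (triple_circ (val z)) (triple_circ_closed z)
|}.

(* Main.v *)
(* Each rule of LET_K^+ is checked semantically: the designated elements of M6
   are the triples whose first coordinate is 1, so once the premises and
   discharged subderivations are read off under a fixed valuation, the soundness
   of a rule is an inspection of the values of at most three formulas. *)
Require Import Defs.
From mathcomp Require Import all_boot.
From mathcomp Require Import classical_sets.

Local Open Scope classical_set_scope.

Lemma designatedP (z : M6) : designated z <-> (val z).1.1.
Proof.
case: z => [[[[] z2] z3] z_ok]; split=> //=; last first.
  by case=> [[]|] /(congr1 val).
(* [z_ok] excludes (1,1,1); what remains is [valb], [valT], [valT0], in this order. *)
by move: z2 z3 z_ok => [] [] // z_ok _; [right | left; left | left; right];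
  apply: val_inj.
Qed.

(** Since [v] need not satisfy a discharged hypothesis, its subderivation survives only as a boolean
    implication, which case analysis can evaluate. *)
Lemma entails_discharge (G : set form) (A C : form) (v : form -> M6) :
  valuation v -> (forall B, G B -> designated (v B)) ->
  entails M6 (G `|` [set A]) C -> (val (v A)).1.1 ==> (val (v C)).1.1.
Proof.
move=> v_hom vG GA_C; apply/implyP=> /designatedP vA; apply/designatedP.
by apply: GA_C => // B [/vG | ->].
Qed.

Theorem theorem3p12 (G : set form) (A : form) :
  LETKplus G A -> entails M6 G A.
Proof.
elim=> {G A}; first by move=> G A GA v _; apply.
all: intros; move=> v v_hom vG; apply/designatedP.
all: repeat match goal with
  | H : entails M6 (_ `|` _) _ |- _ =>
      move/(entails_discharge _ _ _ _ v_hom vG): H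
  | H : entails M6 _ _ |- _ => move/(_ v v_hom vG)/designatedP: H
  end.
all: rewrite ?(val_and v_hom, val_or v_hom, val_imp v_hom, val_neg v_hom,
  val_circ v_hom).
(* Only schematic letters are left under the valuation; each runs over the eight bit triples, the
   two outside the domain being absurd. *)
all: match goal with _ : valuation ?w |- _ =>
  repeat match goal with
  | |- context [w ?B] => case: (w B) => [[[[] []] []]] //
  end end.
all: by [].
Qed.
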